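(* Let $M$ be a matroid representable over a field $\mathbb{F}$. Then, for each integer $k$ with $1\le k\le r^*(M)$, there is a rank-$k$ matroid $N$ on the set of circuits of $M$ with the following property: if $\mathcal{C}'$ is a perfect collection of circuits of $M$, then each circuit $C'$ of $M$ contained in $\bigcup_{C\in\mathcal{C}'}C$ satisfies $C'\in\mathrm{cl}_N(\mathcal{C}')$.
   Context: Matroids are finite; $r^*(M)=|E(M)|-r(M)$ is the corank of $M$ (the rank of the dual matroid $M^*$), and $\mathrm{cl}_N$ is the closure operator of $N$. A matroid on the set of circuits of $M$ is a matroid whose ground set is the set of circuits of $M$. A collection $\mathcal{C}'$ of circuits of $M$ is perfect if $|\bigcup_{C\in\mathcal{C}'}C|-r_M(\bigcup_{C\in\mathcal{C}'}C)=|\mathcal{C}'|$, and no circuit in $\mathcal{C}'$ is contained in the union of the others. *)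

(* Defs.v *)
From mathcomp Require Import all_boot all_algebra.

Set Implicit Arguments.
Unset Strict Implicit.
Unset Printing Implicit Defensive.

(* The ground set is a subset of T rather than all of T, so that the circuits
   of a matroid over T can be the ground set of a matroid over {set T}. *)
Record matroid (T : finType) := Matroid {
  ground : {set T};
  indep : {set {set T}};
  indep_ground : forall I : {set T}, I \in indep -> I \subset ground;
  indep0 : set0 \in indep;
  indep_sub : forall I J : {set T}, J \in indep -> I \subset J -> I \in indep;
  indep_aug : forall I J : {set T}, I \in indep -> J \in indep ->
    #|I| < #|J| ->
    exists2 e, e \in J :\: I & e |: I \in indep
}.

Section MatroidNotions.
Variables (T : finType) (M : matroid T).

Definition mrank (X : {set T}) : nat :=
  \max_(I in indep M | I \subset X) #|I|.

Definition rank_of : nat := mrank (ground M).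

(* The subtraction is never truncated: rank_of <= #|ground M|. *)
Definition corank : nat := #|ground M| - rank_of.

Definition mcl (X : {set T}) : {set T} :=
  [set e in ground M | mrank (e |: X) == mrank X].

Definition dependent (X : {set T}) : bool :=
  (X \subset ground M) && (X \notin indep M).

Definition circuits : {set {set T}} := [set C | minset dependent C].

Definition perfect (P : {set {set T}}) : Prop :=
  [/\ P \subset circuits,
      #|cover P| - mrank (cover P) = #|P|
    & forall C, C \in P -> ~~ (C \subset cover (P :\ C))].

End MatroidNotions.

(* [free] is applied to a sequence, so distinct elements of X represented by
   the same vector make X dependent. *)
Definition representable (F : fieldType) (T : finType) (M : matroid T) : Prop :=
  exists (n : nat) (v : T -> 'cV[F]_n),
    forall X : {set T}, X \subset ground M ->
      (X \in indep M) = free [seq v x | x <- enum X].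

(* Main.v *)
Require Import Defs.
From mathcomp Require Import all_boot all_algebra.
From HB Require Import structures.

(** Let the elements x of M be represented by vectors v x.  For a set X of
    elements, the linear dependencies sum_x c_x v_x = 0 supported on X form a
    space [deps v X] whose dimension is the nullity |X| - r(X), by rank-nullity
    ([dim_deps], [nullity_deps]).  A circuit C supports a nonzero dependency,
    and by minimality of C its support is all of C ([supp_circuit_vec]); fix one
    such vector per circuit.

    The circuit vectors span [deps v (ground M)] ([deps_circuits]), so the
    vector matroid that they define on the circuits of M has rank the corank of
    M.  If P is perfect, each circuit of P has an element that lies in no other
    circuit of P, so the vectors of P are linearly independent; there are as
    many of them as the nullity of [cover P], so they form a basis of
    [deps v (cover P)] ([perfect_span]).  The vector of any circuit inside
    [cover P] belongs to that space, hence to the span of P.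

    This settles k = corank.  For smaller k, truncate the vector matroid to
    rank k: the rank of a set of circuits becomes the minimum of k and the
    dimension of its span ([mrank_vmatroid]), which still depends on the span
    only, so the closure property survives. *)

Set Implicit Arguments.
Unset Strict Implicit.
Unset Printing Implicit Defensive.

Import GRing.Theory.
Local Open Scope ring_scope.

(** * Truncated vector matroids *)

Section VectorMatroid.
Variables (F : fieldType) (vT : vectType F) (U : finType).
Variables (G : {set U}) (w : U -> vT) (k : nat).
Implicit Types X Y I J : {set U}.

Definition vfam X : seq vT := [seq w x | x <- enum X].

Lemma size_vfam X : size (vfam X) = #|X|.
Proof. by rewrite size_map -cardE. Qed.

Lemma vfamP X (V : {vspace vT}) :
  reflect {in X, forall x, w x \in V} (<<vfam X>> <= V)%VS.
Proof.
apply: (iffP span_subvP) => [sXV x Xx | sXV _ /mapP[x + ->]].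
  by apply/sXV/map_f; rewrite mem_enum.
by rewrite mem_enum; apply: sXV.
Qed.

Lemma mem_vfam X x : x \in X -> w x \in <<vfam X>>%VS.
Proof. by move=> Xx; apply/memv_span/map_f; rewrite mem_enum. Qed.

Lemma vfamS X Y : X \subset Y -> (<<vfam X>> <= <<vfam Y>>)%VS.
Proof. by move=> /subsetP sXY; apply/vfamP => x /sXY; apply: mem_vfam. Qed.

Lemma free_vfamU1 e X : e \notin X ->
  free (vfam (e |: X)) = (w e \notin <<vfam X>>%VS) && free (vfam X).
Proof.
move=> Xe; rewrite -free_cons; apply/perm_free.
rewrite -[w e :: _]/(map w (e :: enum X)); apply/perm_map/uniq_perm.
- exact: enum_uniq.
- by rewrite /= mem_enum Xe enum_uniq.
by move=> x; rewrite inE !mem_enum !inE.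
Qed.

(** A family spanning fewer dimensions than its size stays so after adding
    vectors, since each new vector adds at most one dimension. *)
Lemma free_vfamS X Y : X \subset Y -> free (vfam Y) -> free (vfam X).
Proof.
move=> sXY; apply: contraTT; rewrite /free !size_vfam => dX.
have leX : (\dim <<vfam X>> < #|X|)%N.
  by rewrite ltn_neqAle dX -(size_vfam X) dim_span.
rewrite neq_ltn; apply/orP; left.
(* The span of Y is that of X plus at most #|Y :\: X| dimensions. *)
have sY : (<<vfam Y>> <= <<vfam X>> + <<vfam (Y :\: X)>>)%VS.
  apply/vfamP => x Yx; case: (boolP (x \in X)) => Xx.
    by apply/(subvP (addvSl _ _))/mem_vfam.
  by apply/(subvP (addvSr _ _))/mem_vfam; rewrite inE Xx.
apply: leq_ltn_trans (dimvS sY) _; apply: leq_ltn_trans (dimv_add_leqif _ _) _.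
have := dim_span (vfam (Y :\: X)); rewrite size_vfam => leD.
rewrite -(cardsID X Y) (setIidPr sXY) -addSn; exact: leq_add.
Qed.

(** The independent sets of the truncation to rank k of the matroid that [w]
    represents on [G]. *)
Definition vindep : {set {set U}} :=
  [set X : {set U} | [&& X \subset G, (#|X| <= k)%N & free (vfam X)]].

Lemma vindep_ground I : I \in vindep -> I \subset G.
Proof. by rewrite inE => /and3P[]. Qed.

Lemma vindep0 : set0 \in vindep.
Proof. by rewrite inE sub0set cards0 /vfam enum_set0 nil_free. Qed.

Lemma vindep_sub I J : J \in vindep -> I \subset J -> I \in vindep.
Proof.
rewrite !inE => /and3P[sJG leJ fJ] sIJ.
by rewrite (subset_trans sIJ) // (leq_trans (subset_leq_card sIJ)) //
           (free_vfamS sIJ).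
Qed.

(** Stated for any spanning deficit rather than for a larger independent set,
    so that it gives both the exchange axiom and the fact that a maximum
    independent subset of X of size less than k spans X. *)
Lemma vindep_extend I X : I \in vindep -> X \subset G ->
    (#|I| < k)%N -> ~~ (<<vfam X>> <= <<vfam I>>)%VS ->
  exists2 e, e \in X :\: I & e |: I \in vindep.
Proof.
rewrite inE => /and3P[sIG _ fI] sXG ltk nsub.
have [e Xe wIe] : exists2 e, e \in X & w e \notin <<vfam I>>%VS.
  apply/exists_inP; apply: contraR nsub; rewrite negb_exists_in => /forall_inP h.
  by apply/vfamP => x /h; rewrite negbK.
have Ie : e \notin I by apply: contra wIe; apply: mem_vfam.
exists e; first by rewrite inE Ie.
by rewrite inE subUset sub1set (subsetP sXG) // sIG cardsU1 Ie ltk free_vfamU1 ?wIe.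
Qed.

Lemma vindep_aug I J : I \in vindep -> J \in vindep -> (#|I| < #|J|)%N ->
  exists2 e, e \in J :\: I & e |: I \in vindep.
Proof.
move=> iI; rewrite inE => /and3P[sJG leJ /eqP dJ] ltIJ.
apply: vindep_extend => //; first exact: leq_trans ltIJ leJ.
apply/negP => /dimvS; rewrite dJ size_vfam leqNgt => /negP; apply.
by apply: leq_ltn_trans (dim_span _) _; rewrite size_vfam.
Qed.

Definition vmatroid : matroid U :=
  Matroid vindep_ground vindep0 vindep_sub vindep_aug.

Lemma mrank_vmatroid X : X \subset G ->
  mrank vmatroid X = minn k (\dim <<vfam X>>).
Proof.
move=> sXG; rewrite /mrank /=; apply/eqP; rewrite eqn_leq; apply/andP; split.
  apply/bigmax_leqP => I /andP[]; rewrite inE => /and3P[_ leI /eqP dI] sIX.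
  by rewrite leq_min leI -(size_vfam I) -dI dimvS // vfamS.
have P0 : (set0 \in vindep) && (set0 \subset X) by rewrite vindep0 sub0set.
rewrite (bigmax_eq_arg set0) ?P0 //.
case: arg_maxnP => // I /andP[iI sIX] maxI.
(* Either the maximum set I reaches the truncation bound k, or it spans X. *)
rewrite geq_min; case: leqP => //= ltIk.
have sub : (<<vfam X>> <= <<vfam I>>)%VS.
  apply: contraT => /(vindep_extend iI sXG ltIk)[e /setDP[Xe Ie] iI'].
  have := maxI (e |: I); rewrite iI' subUset sub1set Xe sIX cardsU1 Ie.
  by move/(_ isT); rewrite /= add1n ltnn.
by apply: leq_trans (dimvS sub) _; rewrite -(size_vfam I) dim_span.
Qed.

End VectorMatroid.

(** * Linear dependencies supported on a set *)

Section Dependencies.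
Variables (F : fieldType) (vT : vectType F) (T : finType) (v : T -> vT).
Implicit Types (X Y : {set T}) (c : {ffun T -> F^o}).

Definition combine c : vT := \sum_x (c x : F) *: v x.

Fact combine_is_linear : linear combine.
Proof.
move=> a b c; rewrite /combine scaler_sumr -big_split; apply: eq_bigr => x _ /=.
by rewrite !ffunE scalerDl scalerA.
Qed.
HB.instance Definition _ :=
  GRing.isLinear.Build F {ffun T -> F^o} vT _ combine combine_is_linear.

(** The projection that forgets the coordinates in [X]; its kernel consists of
    the functions supported on [X]. *)
Definition outside X c : {ffun T -> F^o} :=
  [ffun x => if x \in X then 0 else c x].

Fact outside_is_linear X : linear (outside X).
Proof.
move=> a b c; apply/ffunP => x; rewrite !ffunE.
by case: ifP => //; rewrite scaler0 addr0.
Qed.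
HB.instance Definition _ X :=
  GRing.isLinear.Build F {ffun T -> F^o} {ffun T -> F^o} _ (outside X)
    (outside_is_linear X).

Definition supported X : {vspace {ffun T -> F^o}} := lker (linfun (outside X)).

Lemma supportedP X c :
  reflect (forall x, x \notin X -> c x = 0) (c \in supported X).
Proof.
rewrite memv_ker lfunE; apply: (iffP eqP) => [/ffunP h x Xx | h].
  by have := h x; rewrite !ffunE (negPf Xx).
by apply/ffunP=> x; rewrite !ffunE; case: ifPn => // /h.
Qed.

Definition unitf x : {ffun T -> F^o} := [ffun y => (y == x)%:R].

Lemma ffun_unitf_sum X c : c \in supported X ->
  c = \sum_(x in X) (c x : F) *: unitf x.
Proof.
move=> /supportedP cX; apply/ffunP => y; rewrite sum_ffunE.
rewrite (eq_bigr (fun x => if x == y then c y else 0)) => [|x Xx]; last first.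
  by rewrite !ffunE eq_sym; case: eqP => [->|_]; rewrite /GRing.scale /= ?mulr1 ?mulr0.
rewrite -big_mkcondr /=; have [Xy|Xy] := boolP (y \in X).
  by rewrite (big_pred1 y) // => x /=; case: eqP => [->|]; rewrite ?Xy ?andbF.
by rewrite cX // big_pred0 // => x /=; case: eqP => [->|]; rewrite ?(negPf Xy) ?andbF.
Qed.

Lemma supported_span X : supported X = <<vfam unitf X>>%VS.
Proof.
apply/eqP; rewrite eqEsubv; apply/andP; split.
  apply/subvP => c /ffun_unitf_sum ->; apply: memv_suml => x Xx.
  exact/memvZ/mem_vfam.
apply/vfamP => x Xx; apply/supportedP => y Xy; rewrite ffunE.
by case: eqP Xy => // ->; rewrite Xx.
Qed.


(** Add the vectors one at a time: the span of those already present vanishes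
    at the private coordinate of the new one. *)
Lemma free_vfam_private (U : finType) (w : U -> {ffun T -> F^o}) (P : {set U}) :
    {in P, forall u, exists2 x, w u x != 0 & {in P :\ u, forall t, w t x = 0}} ->
  free (vfam w P).
Proof.
move=> privP; have [n] := ubnP #|P|; elim: n P privP => // n IH P privP.
have [-> _|[u Pu]] := set_0Vmem P; first by rewrite /vfam enum_set0 nil_free.
rewrite (cardsD1 u) Pu => /= ltPn; rewrite -(setD1K Pu) free_vfamU1 ?setD11 //.
apply/andP; split; last first.
  apply: IH => // t /setD1P[_ /privP[x wtx others]].
  by exists x => // s /setD1P[st /setD1P[_ Ps]]; rewrite others // !inE st.
have [x wux others] := privP u Pu.
have /subvP sub : (<<vfam w (P :\ u)>> <= supported (~: [set x]))%VS.
  apply/vfamP => t Pt; apply/supportedP => y; rewrite !inE negbK => /eqP ->.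
  exact: others.
by apply: contra wux => /sub/supportedP -> //; rewrite !inE eqxx.
Qed.

Lemma dim_supported X : \dim (supported X) = #|X|.
Proof.
rewrite supported_span (eqnP (free_vfam_private _)) ?size_vfam // => x Xx.
exists x => [|t /setD1P[tx _]]; rewrite ffunE ?eqxx ?oner_eq0 //.
by rewrite eq_sym (negPf tx).
Qed.

Definition deps X : {vspace {ffun T -> F^o}} :=
  (supported X :&: lker (linfun combine))%VS.

Lemma depsP X c :
  reflect ((forall x, x \notin X -> c x = 0) /\ combine c = 0) (c \in deps X).
Proof.
rewrite memv_cap memv_ker lfunE; apply: (iffP andP).
  by case=> /supportedP ? /eqP.
by case=> ? /eqP ?; split=> //; apply/supportedP.
Qed.

Lemma depsS X Y : X \subset Y -> (deps X <= deps Y)%VS.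
Proof.
move=> /subsetP sXY; apply/subvP => c /depsP[cX c0]; apply/depsP; split=> // x Yx.
by apply/cX/(contra (sXY x)).
Qed.

Lemma combine_unitf x : combine (unitf x) = v x.
Proof.
rewrite /combine (bigD1 x) //= ffunE eqxx scale1r big1 ?addr0 // => y yx.
by rewrite ffunE (negPf yx) scale0r.
Qed.

(** Rank-nullity for [combine] restricted to the functions supported on X:
    its kernel there is [deps X] and its image is the span of the [v x]. *)
Lemma dim_deps X : (\dim (deps X) + \dim <<vfam v X>>)%N = #|X|.
Proof.
rewrite -dim_supported -(limg_ker_dim (linfun combine) (supported X)).
congr (_ + \dim _)%N; rewrite supported_span limg_span -map_comp.
by congr <<_>>%VS; apply: eq_map => x /=; rewrite lfunE; rewrite /= combine_unitf.
Qed.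

Lemma free_deps X : free (vfam v X) = (deps X == 0%VS).
Proof.
by rewrite -dimv_eq0 /free size_vfam -(dim_deps X) -[X in X == _]add0n eqn_add2r
           eq_sym.
Qed.

Definition supp c : {set T} := [set x | c x != 0].

Lemma deps_supp X c : c \in deps X -> c \in deps (supp c).
Proof.
case/depsP=> _ c0; apply/depsP; split=> // x.
by rewrite inE negbK => /eqP.
Qed.

Lemma supp_sub X c : c \in deps X -> supp c \subset X.
Proof.
case/depsP=> cX _; apply/subsetP => x; rewrite inE.
by apply: contraR => /cX ->.
Qed.

End Dependencies.

(** * Circuit vectors of a represented matroid *)

Section CircuitVectors.
Variables (F : fieldType) (vT : vectType F) (T : finType) (M : matroid T).
Variable v : T -> vT.
Hypothesis v_repr : forall X : {set T}, X \subset ground M ->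
  (X \in indep M) = free (vfam v X).
Implicit Types (X : {set T}) (P : {set {set T}}).

(** [M] is the vector matroid of [v] truncated at #|T|, which is no truncation
    at all. *)
Lemma mrank_repr X : X \subset ground M -> mrank M X = \dim <<vfam v X>>.
Proof.
move=> sXM; have le_dim : (\dim <<vfam v X>> <= #|T|)%N.
  by rewrite (leq_trans (dim_span _)) // size_vfam max_card.
rewrite -(minn_idPr le_dim) -(mrank_vmatroid _ _ sXM) /mrank.
apply: eq_bigl => I; congr (_ && _) => /=; rewrite inE max_card /=.
have [/v_repr //|nIM] := boolP (I \subset ground M).
by apply: contraNF nIM => /indep_ground.
Qed.

Lemma nullity_deps X : X \subset ground M ->
  (#|X| - mrank M X)%N = \dim (deps v X).
Proof. by move=> sXM; rewrite mrank_repr // -(dim_deps v X) addnK. Qed.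

Lemma dependent_deps X :
  dependent M X = (X \subset ground M) && (deps v X != 0%VS).
Proof.
by rewrite /dependent; case: (boolP (X \subset _)) => //= /v_repr ->; rewrite free_deps.
Qed.

Lemma circuits_sub C : C \in circuits M -> C \subset ground M.
Proof. by rewrite inE => /minsetp/andP[]. Qed.

Lemma cover_circuits_sub P : P \subset circuits M -> cover P \subset ground M.
Proof.
by move=> /subsetP sPC; apply/bigcupsP => C /sPC; apply: circuits_sub.
Qed.

(** An arbitrary nonzero dependency on C when there is one; for a circuit it is
    unique up to a scalar. *)
Definition circuit_vec (C : {set T}) : {ffun T -> F^o} := vpick (deps v C).

Lemma circuit_vec_deps C : circuit_vec C \in deps v C.
Proof. exact: memv_pick. Qed.

Lemma supp_dependent X c : X \subset ground M -> c \in deps v X -> c != 0 ->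
  dependent M (supp c).
Proof.
move=> sXM Xc c0; rewrite dependent_deps (subset_trans (supp_sub Xc)) //=.
by apply: contra c0 => /eqP d0; have := deps_supp Xc; rewrite d0 memv0.
Qed.

(** The support is a dependent subset of C, so minimality of C forces
    equality. *)
Lemma supp_circuit_vec C : C \in circuits M -> supp (circuit_vec C) = C.
Proof.
move=> circC; have Cc := circuit_vec_deps C.
have sCM := circuits_sub circC.
move: circC; rewrite inE => /minsetP[]; rewrite dependent_deps => /andP[_ dC].
by apply; [apply: supp_dependent Cc _; rewrite // vpick0 | apply: supp_sub Cc].
Qed.

(** Induction on the size of the support of a dependency c: the support is
    dependent, hence contains a circuit C, and subtracting a multiple of the
    vector of C cancels one coordinate of c without creating new ones. *)
Lemma deps_circuits : deps v (ground M) = <<vfam circuit_vec (circuits M)>>%VS.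
Proof.
apply/eqP; rewrite eqEsubv; apply/andP; split; last first.
  apply/vfamP => C /circuits_sub/depsS/subvP; apply; exact: circuit_vec_deps.
apply/subvP => c; have [n] := ubnP #|supp c|; elim: n c => // n IH c le_cn Mc.
have [->|c0] := eqVneq c 0; first exact: mem0v.
have [C minC sCc] := minset_exists (supp_dependent (subxx _) Mc c0).
have circC : C \in circuits M by rewrite inE.
have wCM : circuit_vec C \in deps v (ground M).
  exact: (subvP (depsS _ (circuits_sub circC))) (circuit_vec_deps C).
have [e Ce] : exists e, e \in C.
  apply/set0Pn; apply: contraTneq (minsetp minC) => ->.
  by rewrite /dependent indep0 andbF.
have we0 : circuit_vec C e != 0.
  by move: Ce; rewrite -{1}(supp_circuit_vec circC) inE.
(* This multiple makes coordinate e vanish. *)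
pose a : F := c e / circuit_vec C e.
have -> : c = (c - a *: circuit_vec C) + a *: circuit_vec C by rewrite subrK.
apply: rpredD; last exact/memvZ/mem_vfam.
apply: IH; last by rewrite rpredB ?memvZ.
rewrite -ltnS; apply: leq_trans le_cn; rewrite ltnS; apply/proper_card/properP; split.
  apply/subsetP => x; rewrite !inE !ffunE; apply: contraNneq => cx0.
  have /eqP -> : circuit_vec C x == 0.
    rewrite -[_ == 0]negbK; apply/negP => wx.
    have : x \in C by rewrite -(supp_circuit_vec circC) inE.
    by move/(subsetP sCc); rewrite inE cx0 eqxx.
  by rewrite cx0 scaler0 subrr.
exists e; first exact: (subsetP sCc).
by rewrite inE !ffunE negbK /a /GRing.scale /= divfK // subrr.
Qed.

(** Private elements make the vectors of P independent, and the nullity condition makes their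
    number equal to the dimension of the space that contains them. *)
Lemma perfect_span P : perfect M P ->
  <<vfam circuit_vec P>>%VS = deps v (cover P).
Proof.
case=> sPC cardP privP; have sPM := cover_circuits_sub sPC.
apply/eqP; rewrite eqEdim; apply/andP; split.
  apply/vfamP => C PC; apply: (subvP (depsS _ (bigcup_sup C PC))).
  exact: circuit_vec_deps.
rewrite -nullity_deps // cardP.
rewrite (eqnP (free_vfam_private _)) ?size_vfam // => C PC.
have /subsetPn[x Cx nx] := privP C PC.
exists x => [|D PD].
  by move: Cx; rewrite -{1}(supp_circuit_vec (subsetP sPC C PC)) inE.
have /depsP[-> //] := circuit_vec_deps D.
by apply: contra nx => Dx; apply/bigcupP; exists D.
Qed.

End CircuitVectors.

(** * The matroid on the circuits *)

Local Close Scope ring_scope.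

Theorem theorem1p5 (F : fieldType) (T : finType) (M : matroid T)
    (M_repr : representable F M) (k : nat) (k_bounds : 1 <= k <= corank M) :
  exists N : matroid {set T},
    [/\ ground N = circuits M,
        rank_of N = k
      & forall P : {set {set T}}, perfect M P ->
          forall C : {set T}, C \in circuits M -> C \subset cover P ->
            C \in mcl N P].
Proof.
have [n [v v_repr]] := M_repr; have /andP[_ le_k] := k_bounds.
exists (vmatroid (circuits M) (circuit_vec v) k); split=> //.
  rewrite /rank_of mrank_vmatroid //= -(deps_circuits v_repr).
  by rewrite -(nullity_deps v_repr) //; apply/minn_idPl.
move=> P perfP C circC sCP; have [sPC _ _] := perfP.
rewrite inE circC !mrank_vmatroid // ?subUset ?sub1set ?circC //=.
(* In the truncation, rank depends on the span only. *)
suff -> : <<vfam (circuit_vec v) (C |: P)>>%VS = <<vfam (circuit_vec v) P>>%VS by [].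
apply/eqP; rewrite eqEsubv (vfamS _ (subsetUr _ _)) andbT; apply/vfamP => D.
case/setU1P=> [->|]; last exact: mem_vfam.
rewrite (perfect_span v_repr perfP).
exact: (subvP (depsS _ sCP)) (circuit_vec_deps v C).
Qed.
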